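(* Fix positive integers $\Delta$ and $q$. For every sufficiently large $n \in \mathbb{N}$ (depending on $\Delta$ and $q$) such that $\Delta n$ is even, there exists a triangle-free $\Delta$-regular graph $G$ with $|V(G)| = n$ (and hence $m = |E(G)| = \Delta n/2$ edges) such that $$c(G,q) \,\leq\, \left(1-\frac{1}{q}\right)^m \bigl((1+\gamma)q\bigr)^n, \qquad \text{where } \gamma = \frac{2\log n}{n}.$$
   Context: All graphs are finite, undirected, and simple; $\log$ is the natural logarithm. For a graph $G$ and a positive integer $q$, $c(G,q)$ denotes the number of proper $q$-colorings of $G$, i.e., of maps $f \colon V(G) \to \{1,\ldots,q\}$ with $f(u)\neq f(v)$ whenever $uv \in E(G)$. *)

(* Defs.v *)
From mathcomp Require Import all_boot all_order all_algebra.

Set Implicit Arguments.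
Unset Strict Implicit.
Unset Printing Implicit Defensive.

Record sgraph := SGraph {
  vertex : finType;
  adj : rel vertex;
  adj_sym : symmetric adj;
  adj_irrefl : irreflexive adj
}.

Definition edges (G : sgraph) : {set {set vertex G}} :=
  [set [set p.1; p.2] | p : vertex G * vertex G & adj p.1 p.2].

Definition neighbors (G : sgraph) (x : vertex G) : {set vertex G} :=
  [set y | adj x y].

Definition regular (d : nat) (G : sgraph) : Prop :=
  forall x : vertex G, #|neighbors x| = d.

Definition triangle_free (G : sgraph) : Prop :=
  forall x y z : vertex G, ~ [/\ adj x y, adj y z & adj z x].

(* The color set {1, ..., q} is represented by 'I_q = {0, ..., q - 1}. *)
Definition proper_coloring (G : sgraph) (q : nat)
    (f : {ffun vertex G -> 'I_q}) : bool :=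
  [forall x, forall y, adj x y ==> (f x != f y)].

Definition num_colorings (G : sgraph) (q : nat) : nat :=
  #|[set f : {ffun vertex G -> 'I_q} | proper_coloring f]|.

(* Main.v *)
Require Import Defs.
From mathcomp Require Import all_boot all_order all_algebra all_fingroup.
From mathcomp Require Import reals sequences exp.
From mathcomp Require Import zify ring lra.
Import Order.TTheory GRing.Theory Num.Theory.

(** The graph is found by averaging over the configuration model.  Give each of
    the [n] vertices [Delta] half-edges, fix a fixed-point-free involution [p] of
    the set [H] of half-edges, and let a uniformly random permutation [s] of [H]
    turn it into the random perfect matching [p ^ s]; joining the end vertices of
    matched half-edges gives a random [Delta]-regular multigraph.

    Few colorings on average.  Fix an assignment of colors to the vertices and
    reveal the matched pairs one by one.  When [M] half-edges are left, at least
    [M ^ 2 / q] of the [M ^ 2] ordered pairs are monochromatic, by Cauchy-Schwarz,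
    so the next pair is bichromatic with probability at most
    [(1 - 1 / q) * M / (M - 1)].  The factors [M / (M - 1)] multiply to at most
    [#|H| + 1], so an assignment is a proper coloring with probability at most
    [(#|H| + 1) * (1 - 1 / q) ^ m]  ([card_proper_on_le]).  Loops and multiple
    edges are allowed here, a loop spoiling every coloring, so the [M] diagonal
    pairs count as monochromatic and no pair of half-edges has to be excluded.

    Many simple triangle-free outcomes.  A proportion of the matchings bounded
    below in terms of [Delta] alone has no cycle of length at most three, loops and
    double edges included ([card_defect_free]).  This is shown by switching: if [a]
    lies on such a cycle and [c] is far from [a], replace the edges
    [{a, mu a}] and [{c, mu c}] by [{a, c}] and [{mu a, mu c}].  There are about
    [#|H|] choices of [c] for each [a].  Conversely, after the switch the old
    partner of [a] is still within distance two of [a], which leaves boundedly many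
    candidates for it; as [a] and its old partner determine the switch, each
    matching is reached at most a constant times [#|H|] times ([switch_count]).
    Used once on all matchings, the count bounds the mean number of half-edges on
    short cycles by a constant, so at least half of the matchings have at most a
    constant number [K] of them.
    Since a switch with [c] itself on no short cycle creates no short cycle
    ([switch_short_cycles]), the same count shows that the number of matchings with
    at most [k] such half-edges exceeds the number with at most [k - 1] by no more
    than a constant factor; [K] steps lead to zero.

    Hence some simple triangle-free outcome has at most
    [C * (#|H| + 1) * (1 - 1 / q) ^ m * q ^ n] proper colorings, with [C] depending
    on [Delta] only.  This prefactor is linear in [n], whereas
    [(1 + 2 * ln n / n) ^ n] grows like [n ^ 2]; the bound [n ^ (3 / 2)] is enough
    ([natM_le_exp_1D_ln]). *)

Set Implicit Arguments.
Unset Strict Implicit.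
Unset Printing Implicit Defensive.

(** * Random matchings and a fixed coloring *)

Lemma card_offdiag (T : finType) (A : {set T}) :
  #|[set u in setX A A | u.1 != u.2]| = (#|A| * #|A|.-1)%N.
Proof.
have cardE : #|[set u in setX A A | u.1 == u.2]| = #|A|.
  rewrite -(card_imset (f := fun x : T => (x, x)) _ (fun x y => @congr1 _ _ fst _ _)).
  apply: eq_card => -[x y]; rewrite !inE /=; apply/andP/imsetP.
    by case=> /andP[xA _] /eqP <-; exists x.
  by case=> z zA [-> ->]; rewrite zA eqxx.
have := cardsX A A; rewrite -(cardsID [set u | u.1 == u.2] (setX A A)) -{1}cardE.
rewrite (_ : _ :&: _ = [set u in setX A A | u.1 == u.2]); last first.
  by apply/setP=> u; rewrite !inE.
rewrite (_ : _ :\: _ = [set u in setX A A | u.1 != u.2]); last first.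
  by apply/setP=> u; rewrite !inE andbC.
rewrite cardE; case: #|A| => [|k] /=; lia.
Qed.

Lemma card_perm_type (T : finType) : #|{perm T}| = #|T|`!.
Proof.
rewrite -cardsT -(card_perm [set: T]); apply: eq_card => s.
by rewrite !inE; symmetry; apply/subsetP => x _; rewrite inE.
Qed.

Section Coloring.
Variables (H : finType) (p : {perm H}).
Hypothesis p_inv : involutive p.
Hypothesis p_nofix : forall x, p x != x.
Variables (q : nat) (g : H -> 'I_q).

(** When [J] is closed under [p], this is the event that the pairs of the random
    matching coming from [J] are all bichromatic. *)
Definition proper_on (J : {set H}) : {set {perm H}} :=
  [set s : {perm H} | [forall x in J, g (s x) != g (s (p x))]].

(** Cauchy-Schwarz on the sizes of the color classes: at least a proportion
    [1 / q] of all ordered pairs is monochromatic. *)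
Lemma card_bichromatic (A : {set H}) (h : H -> 'I_q) :
  (q * #|[set u in setX A A | h u.1 != h u.2]| <= q.-1 * #|A| ^ 2)%N.
Proof.
case: (posnP q) => [q0|q_gt0].
  suff -> : q * #|[set u in setX A A | h u.1 != h u.2]| = 0 by [].
  by rewrite {1}q0.
pose N i := #|[set x in A | h x == i]|.
have cardA : #|A| = \sum_i N i.
  rewrite -sum1_card (partition_big h xpredT) //=; apply: eq_bigr => i _.
  by rewrite /N -sum1_card; apply: eq_bigl => x; rewrite inE.
have cardM : #|[set u in setX A A | h u.1 == h u.2]| = \sum_i N i ^ 2.
  rewrite -sum1_card (partition_big (fun u => h u.1) xpredT) //=.
  apply: eq_bigr => i _; rewrite -mulnn -cardsX -sum1_card; apply: eq_bigl => -[x y].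
  rewrite !inE /=; case: (x \in A); case: (y \in A) => //=; rewrite ?andbF //.
  by rewrite andbC; case: (h x =P i) => //= ->; rewrite eq_sym.
have split_ : #|A| ^ 2 = #|[set u in setX A A | h u.1 == h u.2]|
    + #|[set u in setX A A | h u.1 != h u.2]|.
  rewrite -mulnn -cardsX -(cardsID [set u | h u.1 == h u.2] (setX A A)).
  by congr (_ + _); apply: eq_card => u; rewrite !inE // andbC.
have CS : #|A| ^ 2 <= q * #|[set u in setX A A | h u.1 == h u.2]|.
  rewrite cardM cardA.
  have : 2 * (\sum_i N i) ^ 2 <= 2 * (q * (\sum_i N i ^ 2)).
    have -> : 2 * (q * \sum_i N i ^ 2) = \sum_i \sum_j (N i ^ 2 + N j ^ 2).
      rewrite [RHS](eq_bigr (fun i => q * N i ^ 2 + \sum_j N j ^ 2)) => [|i _].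
        by rewrite big_split /= sum_nat_const card_ord -big_distrr /= mul2n addnn.
      by rewrite big_split /= sum_nat_const card_ord.
    rewrite -mulnn big_distrlr /= big_distrr /=; apply: leq_sum => i _.
    rewrite big_distrr /=; apply: leq_sum => j _; exact: nat_Cauchy.
  by rewrite leq_pmul2l.
move: split_ CS; move: #|[set u in setX A A | h u.1 != h u.2]| => e.
move: #|[set u in setX A A | h u.1 == h u.2]| (#|A| ^ 2) => d w -> le_w.
by rewrite -subn1 mulnBl leq_subRL ?mul1n; nia.
Qed.

Lemma perm2_exists (x x' y z : H) : x != x' -> y != z ->
  exists2 t : {perm H}, t x = y /\ t x' = z &
    forall w, w \notin [set x; x'; y; z] -> t w = w.
Proof.
move=> xx' yz.
exists (tperm x y * tperm (tperm x y x') z)%g.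
  rewrite !permM tpermL tpermL; split=> //.
  rewrite tpermD //; last by rewrite eq_sym.
  by rewrite -[X in _ != X](tpermL x y) (inj_eq perm_inj) eq_sym.
move=> w; rewrite !inE !negb_or => /andP[/andP[/andP[wx wx'] wy] wz].
have t1w : tperm x y w = w by rewrite tpermD // eq_sym.
rewrite permM t1w tpermD //; last by rewrite eq_sym.
by rewrite -[X in _ != X]t1w (inj_eq perm_inj) eq_sym.
Qed.

(** Composing [s] with a permutation that fixes [J] and sends [x], [p x] to any
    two given points [y], [z] outside [J] preserves [proper_on J]; so, given
    [proper_on J], the pair [(s x, s (p x))] is equidistributed with
    [(s y, s z)], and hence with a uniform ordered pair of unused half-edges. *)
Lemma card_proper_step (J : {set H}) (x : H) :
    (forall y, y \in J -> p y \in J) -> x \notin J ->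
  (#|proper_on (x |: (p x |: J))| * (#|~: J| * #|~: J|.-1)
     = \sum_(s in proper_on J)
         #|[set u in setX (~: J) (~: J) | g (s u.1) != g (s u.2)]|)%N.
Proof.
move=> pJ xJ; have pxJ : p x \notin J by apply: contra xJ => /pJ; rewrite p_inv.
pose D := [set u in setX (~: J) (~: J) | u.1 != u.2].
have cardD : #|D| = #|~: J| * #|~: J|.-1 by apply: card_offdiag.
rewrite -cardD mulnC -sum_nat_const.
transitivity (\sum_(s in proper_on J) \sum_(u in D | g (s u.1) != g (s u.2)) 1);
  last first.
  apply: eq_bigr => s _; rewrite sum1_card; apply: eq_card => -[y z].
  rewrite [LHS]unfold_in !inE /=.
  by case: (y =P z) => [->|_]; rewrite ?eqxx ?andbF ?andbT.
rewrite [RHS](exchange_big_dep (mem D)) /= => [|s u _ /andP[]//];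
  apply: eq_bigr => -[y z]; rewrite !inE /=.
move=> /andP[/andP[yJ zJ] yz].
have xpx : x != p x by rewrite eq_sym p_nofix.
(* For each fixed pair [(y, z)], reindexing by [t] turns the right-hand side
   into the left-hand side. *)
have [t [tx tpx] tfix] := perm2_exists xpx yz.
have tJ w : w \in J -> t w = w.
  move=> wJ; apply: tfix; rewrite !inE !negb_or.
  by rewrite (memPn xJ) ?(memPn pxJ) ?(memPn yJ) ?(memPn zJ).
rewrite -sum1_card (reindex_inj (mulgI t)) /=; apply: eq_bigl => s.
rewrite !inE; apply/forall_inP/andP => [sJ | [/forall_inP sJ /andP[_ syz]] w].
  split; last first.
    by have := sJ x; rewrite !permM tx tpx yJ zJ yz setU11; apply.
  apply/forall_inP => w wJ; have := sJ w; rewrite !permM !tJ ?pJ //; apply.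
  by rewrite !inE wJ !orbT.
rewrite !inE => /or3P[/eqP->|/eqP->|wJ]; rewrite !permM ?p_inv ?tx ?tpx //.
  by rewrite eq_sym.
by rewrite !tJ ?pJ // sJ.
Qed.

(** The factor [#|~: J|.+1] telescopes the losses: when the number of unused
    half-edges drops from [M] to [M - 2] it changes by the ratio
    [(M + 1) / (M - 1)], which dominates the loss [M / (M - 1)] of that step.  For
    [J] the whole set it equals one. *)
Lemma card_proper_on_le k (J : {set H}) :
    (forall x, x \in J -> p x \in J) -> #|J| = k.*2 ->
  (#|proper_on J| * q ^ k * #|~: J|.+1 <= q.-1 ^ k * #|H|`! * #|H|.+1)%N.
Proof.
elim: k J => [|k IHk] J pJ cardJ.
  move/eqP: cardJ; rewrite double0 cards_eq0 => /eqP ->.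
  rewrite setC0 cardsT !expn0 muln1 mul1n leq_mul2r /= -card_perm_type.
  exact: max_card.
have /set0Pn[x xJ] : J != set0 by rewrite -cards_eq0 cardJ.
pose K := J :\ x :\ p x.
have xK : x \notin K by rewrite !inE eqxx andbF.
have pxK : p x \notin K by rewrite !inE eqxx.
have pK y : y \in K -> p y \in K.
  rewrite !inE => /and3P[ypx yx yJ]; rewrite (inj_eq perm_inj) yx pJ // andbT.
  by apply: contra ypx => /eqP <-; rewrite p_inv.
have JE : J = x |: (p x |: K).
  rewrite /K setD1K; first by rewrite setD1K.
  by rewrite !inE p_nofix pJ.
have cardJK : #|J| = #|K|.+2.
  by rewrite JE !cardsU1 pxK in_setU1 negb_or eq_sym p_nofix xK.
have cardK : #|K| = k.*2 by move: cardJ; rewrite cardJK doubleS => -[].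
have step := card_proper_step pK xK; rewrite -JE in step.
have cardCJ : #|~: K| = (#|~: J|).+2.
  by move: (cardsC J) (cardsC K); rewrite cardJK; lia.
have le_step : q * (#|proper_on J| * (#|~: K| * #|~: K|.-1))
    <= #|proper_on K| * (q.-1 * #|~: K| ^ 2).
  rewrite step big_distrr /= -sum_nat_const; apply: leq_sum => s _.
  exact: (card_bichromatic (~: K) (g \o s)).
have {}le_step : q * (#|proper_on J| * #|~: J|.+1) <= #|proper_on K| * (q.-1 * #|~: K|).
  move: le_step; rewrite cardCJ /= -(@leq_pmul2l (#|~: J|.+2)) //; nia.
have := IHk K pK cardK; rewrite !expnS.
move: le_step; move: #|proper_on J| #|proper_on K| #|~: J|.+1 #|~: K| => a b u w.
move: (q ^ k) (q.-1 ^ k) (#|H|`!) (#|H|.+1) => e1 e2 e3 e4 le1 le2.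
apply: leq_trans (_ : e1 * (b * (q.-1 * w)) <= _).
  by rewrite -mulnA (mulnC a) -!mulnA mulnCA leq_mul2l; apply/orP; right; lia.
apply: leq_trans (_ : q.-1 * (b * e1 * w.+1) <= _); nia.
Qed.
End Coloring.

(** * Short cycles in a matching of half-edges *)

Section ShortCycles.
Variables (H V : finType) (v : H -> V).

(** There is a walk of at most two edges of the multigraph from [v x] to [v y]
    which leaves no vertex through a half-edge of [A]; if [A] is closed under [mu],
    such a walk avoids the edges that [A] consists of. *)
Definition linked (mu : H -> H) (A : {set H}) (x y : H) : bool :=
  [|| v x == v y,
      [exists h, [&& h \notin A, v h == v x & v (mu h) == v y]]
    | [exists h, exists k, [&& h \notin A, k \notin A, v h == v x,
         v k == v (mu h) & v (mu k) == v y]]].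

Variant linked_spec (mu : H -> H) (A : {set H}) (x y : H) : Prop :=
| Linked0 of v x = v y
| Linked1 h of h \notin A & v h = v x & v (mu h) = v y
| Linked2 h k of h \notin A & k \notin A & v h = v x & v k = v (mu h) & v (mu k) = v y.

Lemma linkedP mu A x y : reflect (linked_spec mu A x y) (linked mu A x y).
Proof.
apply: (iffP or3P) => [[/eqP|/existsP[h /and3P[hA /eqP hx /eqP hy]]
    |/existsP[h /existsP[k /and5P[hA kA /eqP hx /eqP hk /eqP hy]]]]
  |[xy|h hA hx hy|h k hA kA hx hk hy]].
- exact: Linked0.
- exact: Linked1 hA hx hy.
- exact: Linked2 hA kA hx hk hy.
- by constructor 1; apply/eqP.
- by constructor 2; apply/existsP; exists h; rewrite hA hx hy !eqxx.
- by constructor 3; apply/existsP; exists h; apply/existsP; exists k;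
    rewrite hA kA hx hk hy !eqxx.
Qed.

Lemma linked_sym mu (A : {set H}) x y :
  involutive mu -> (forall h, h \in A -> mu h \in A) ->
  linked mu A x y -> linked mu A y x.
Proof.
move=> muK muA.
have muN h : h \notin A -> mu h \notin A by apply: contra => /muA; rewrite muK.
move=> /linkedP[xy|h hA hx hy|h k hA kA hx hk hy]; apply/linkedP.
- exact: Linked0.
- by apply: (Linked1 (muN _ hA)); rewrite ?muK.
- by apply: (Linked2 (muN _ kA) (muN _ hA)); rewrite ?muK.
Qed.

Lemma linked_agree (mu mu' : H -> H) (A : {set H}) x y :
  (forall h, h \notin A -> mu h = mu' h) -> linked mu A x y -> linked mu' A x y.
Proof.
move=> E /linkedP[xy|h hA hx hy|h k hA kA hx hk hy]; apply/linkedP.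
- exact: Linked0.
- by apply: (Linked1 hA hx); rewrite -?E.
- by apply: (Linked2 hA kA hx); rewrite -?E.
Qed.

Lemma linkedS mu (A B : {set H}) x y : A \subset B -> linked mu B x y -> linked mu A x y.
Proof.
move=> AB; have N h : h \notin B -> h \notin A by apply: contra; apply: (subsetP AB).
move=> /linkedP[xy|h hA hx hy|h k hA kA hx hk hy]; apply/linkedP.
- exact: Linked0.
- exact: Linked1 (N _ hA) hx hy.
- exact: Linked2 (N _ hA) (N _ kA) hx hk hy.
Qed.

(** A half-edge used by such a walk starts at a vertex linked to [x], so half-edges
    not linked to [x] are avoided for free. *)
Lemma linked_avoid mu (A B : {set H}) x y :
  (forall c, c \in B -> ~~ linked mu set0 x c) ->
  linked mu A x y -> linked mu (A :|: B) x y.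
Proof.
move=> far.
have N0 h : v h = v x -> h \notin B.
  by move=> hx; apply/negP=> /far/linkedP; apply; apply: Linked0.
have N1 h k : v h = v x -> v k = v (mu h) -> k \notin B.
  by move=> hx hk; apply/negP=> /far/linkedP; apply; apply: (Linked1 (h := h));
    rewrite ?inE.
move=> /linkedP[xy|h hA hx hy|h k hA kA hx hk hy]; apply/linkedP.
- exact: Linked0.
- by apply: (Linked1 _ hx hy); rewrite inE negb_or hA N0.
- by apply: (Linked2 _ _ hx hk hy);
    rewrite inE negb_or ?hA ?kA ?(N0 _ hx) ?(N1 _ _ hx hk).
Qed.

(** The edge [{x, mu x}] lies on a cycle of length at most three of the multigraph:
    it is a loop, has a parallel edge or lies in a triangle (if the walk uses a
    loop, [v x] and [v (mu x)] are joined by a shorter one). *)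
Definition on_short_cycle mu x := linked mu [set x; mu x] (mu x) x.

Lemma on_short_cycle_sym mu x : involutive mu ->
  on_short_cycle mu x -> on_short_cycle mu (mu x).
Proof.
move=> muK; rewrite /on_short_cycle muK setUC => /linked_sym; apply=> // h.
by rewrite !inE => /orP[] /eqP ->; rewrite ?muK eqxx ?orbT.
Qed.

Section Ball.
Variable d : nat.
Hypothesis deg : forall u, #|[set h | v h == u]| <= d.

Lemma card_step (A : {set H}) (w : H -> V) :
  #|[set k | [exists h in A, v k == w h]]| <= #|A| * d.
Proof.
have -> : [set k | [exists h in A, v k == w h]] = \bigcup_(h in A) [set k | v k == w h].
  apply/setP=> k; rewrite inE; apply/exists_inP/bigcupP => -[h hA]; last rewrite inE.
    by move=> e; exists h; rewrite // inE.
  by exists h.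
apply: leq_trans (_ : \sum_(h in A) #|[set k | v k == w h]| <= _).
  elim/big_rec2: _ => [|h m B _ le_B]; first by rewrite cards0.
  by apply: leq_trans (leq_card_setU _ _) _; rewrite leq_add2l.
by rewrite -sum_nat_const leq_sum.
Qed.

(** The walks of length zero, one and two contribute one term each. *)
Lemma card_ball mu x : #|[set y | linked mu set0 x y]| <= d + d ^ 2 + d ^ 3.
Proof.
pose B0 := [set y | v y == v x].
pose B1 := [set k | [exists h in B0, v k == v (mu h)]].
pose B2 := [set k | [exists h in B1, v k == v (mu h)]].
have sub : [set y | linked mu set0 x y] \subset B0 :|: B1 :|: B2.
  apply/subsetP=> y; rewrite !inE => /linkedP[xy|h _ hx hy|h k _ _ hx hk hy].
  - by rewrite xy eqxx.
  - by apply/orP; left; apply/orP; right; apply/exists_inP; exists h;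
      rewrite ?inE ?hx ?hy ?eqxx.
  - apply/orP; right; apply/exists_inP; exists k; rewrite ?inE ?hy //.
    by apply/exists_inP; exists h; rewrite ?inE ?hx ?hk ?eqxx.
apply: leq_trans (subset_leq_card sub) _.
apply: leq_trans (leq_card_setU _ _) _.
have c0 : #|B0| <= d := deg _.
have c1 : #|B1| <= d ^ 2.
  by apply: leq_trans (card_step _ _) _; rewrite -mulnn leq_mul2r c0 orbT.
have c2 : #|B2| <= d ^ 3.
  by apply: leq_trans (card_step _ _) _; rewrite expnSr leq_mul2r c1 orbT.
apply: leq_add => //; apply: leq_trans (leq_card_setU _ _) _; exact: leq_add.
Qed.
End Ball.

(** * Switchings *)

(** The edges [{a, b}] and [{c, d}] of [mu] are replaced by [{a, c}] and [{b, d}].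
    The edges are far apart, so a short cycle of [mu'] through a new edge has to
    use both, which forces [c] and [d] to be joined outside the edge [{c, d}]
    by a walk of length at most one; then [c] lies on a short cycle of [mu].
    The proofs below run through all positions of the at most two further
    half-edges. *)
Section Switch.
Variables (mu mu' : H -> H) (a b c d : H).
Hypotheses (muK : involutive mu) (mu'K : involutive mu').
Hypotheses (mua : mu a = b) (muc : mu c = d) (mu'a : mu' a = c) (mu'b : mu' b = d).
Hypothesis agree : forall h, h \notin [set a; b; c; d] -> mu' h = mu h.
Hypothesis far :
  forall x y, x \in [set a; b] -> y \in [set c; d] -> ~~ linked mu set0 x y.
Hypothesis c_ok : ~~ on_short_cycle mu c.

Let mub : mu b = a. Proof. by rewrite -mua muK. Qed.
Let mud : mu d = c. Proof. by rewrite -muc muK. Qed.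
Let mu'c : mu' c = a. Proof. by rewrite -mu'a mu'K. Qed.
Let mu'd : mu' d = b. Proof. by rewrite -mu'b mu'K. Qed.

Let near x y : Prop := (x = a \/ x = b) /\ (y = c \/ y = d).
Let farS x y : near x y -> ~ linked_spec mu set0 x y.
Proof.
by case=> xab ycd /linkedP; apply/negP/far; rewrite !inE; apply/orP; rewrite -?(rwP eqP).
Qed.
Let far0 x y : near x y -> v x <> v y.
Proof. by move=> /farS nl xy; apply: nl; exact: Linked0. Qed.
Let far1 x y h : near x y -> v h = v x -> v (mu h) <> v y.
Proof.
by move=> /farS nl hx hy; apply: nl; apply: (@Linked1 _ _ _ _ h); rewrite ?inE.
Qed.
Let far2 x y h k : near x y -> v h = v x -> v k = v (mu h) -> v (mu k) <> v y.
Proof.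
by move=> /farS nl hx hk hy; apply: nl; apply: (@Linked2 _ _ _ _ h k); rewrite ?inE.
Qed.
Let far1' x y h : near x y -> v h = v y -> v (mu h) <> v x.
Proof. by move=> nxy hy hx; apply: (@far1 x y (mu h)); rewrite ?muK. Qed.
Let far2' x y h k : near x y -> v h = v y -> v k = v (mu h) -> v (mu k) <> v x.
Proof. by move=> nxy hy hk hx; apply: (@far2 x y (mu k) (mu h)); rewrite ?muK. Qed.
Let cd_loop : v c <> v d.
Proof.
move=> cd; move/negP: c_ok; apply; apply/linkedP; rewrite muc; exact: Linked0.
Qed.
Let cd_par h : h <> c -> h <> d -> v h = v d -> v (mu h) <> v c.
Proof.
move=> /eqP hc /eqP hd hvd hvc; move/negP: c_ok; apply; apply/linkedP; rewrite muc.
by apply: (@Linked1 _ _ _ _ h) => //; rewrite !inE negb_or hc hd.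
Qed.
Let cd_par' h : h <> c -> h <> d -> v h = v c -> v (mu h) <> v d.
Proof.
move=> hc hd hvc hvd; apply: (@cd_par (mu h)); rewrite ?muK //.
  by move=> e; apply: hd; rewrite -muc -e muK.
by move=> e; apply: hc; rewrite -mud -e muK.
Qed.

Let nac : near a c. Proof. by split; auto. Qed.
Let nad : near a d. Proof. by split; auto. Qed.
Let nbc : near b c. Proof. by split; auto. Qed.
Let nbd : near b d. Proof. by split; auto. Qed.

(** The three other new half-edges are covered by reversing a cycle and by
    exchanging the roles of [(a, c)] and [(b, d)]. *)
Lemma fresh_a : ~~ on_short_cycle mu' a.
Proof.
apply/negP; rewrite /on_short_cycle mu'a.
have split_ h : h \notin [set a; c] ->
    [\/ h = b, h = d | mu' h = mu h /\ (h <> c /\ h <> d)].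
  case: (h =P b) => [|hb]; first by constructor 1.
  case: (h =P d) => [|hd]; first by constructor 2.
  move=> hac; constructor 3; move: hac; rewrite !inE => /norP[/eqP ha /eqP hc].
  by split=> //; apply: agree; rewrite !inE !negb_or; do !(apply/andP; split); apply/eqP.
move=> /linkedP[xy|h /split_ sh hx hy|h k /split_ sh /split_ sk hx hk hy].
- exact: (far0 nac).
- case: sh hx hy => [->|->|[->[hc hd]]] hx hy.
  + exact: (far0 nbc).
  + by apply: cd_loop.
  + exact: (far1' nac hx).
- case: sh hx hk => [->|->|[->[hc hd]]] hx hk.
  + exact: (far0 nbc).
  + by apply: cd_loop.
  + case: sk hk hy => [->|->|[->[kc kd]]] hk hy.
    * exact: (far1' nbc hx).
    * exact: (@cd_par' h).
    * exact: (far2' nac hx hk).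
Qed.

Lemma old_short_cycle x : x \notin [set a; b; c; d] ->
  on_short_cycle mu' x -> on_short_cycle mu x.
Proof.
move=> xA; rewrite /on_short_cycle (agree xA); have := muK x.
have yA : mu x \notin [set a; b; c; d].
  apply: contra xA; rewrite !inE -!orbA.
  by case/or4P=> /eqP e; rewrite -(muK x) e ?mua ?mub ?muc ?mud eqxx ?orbT.
move: yA; set y := mu x => yA muy; have mux : mu x = y by [].
have [yc yd] : y <> c /\ y <> d.
  by split=> e; move: yA; rewrite e !inE eqxx ?orbT.
have split_ h : [\/ h = a, h = b, h = c | h = d \/ mu' h = mu h].
  have [hA|/agree ->] := boolP (h \in [set a; b; c; d]); last by constructor 4; right.
  move: hA; rewrite !inE -!orbA => /or4P[]/eqP->; by [constructor|constructor 4; left].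
move=> /linkedP[xy|h hx sh hy|h k hN kN hx hk hy]; apply/linkedP.
- exact: Linked0.
- case: (split_ h) hy => [e|e|e|[e|->]]; rewrite ?e ?mu'a ?mu'b ?mu'c ?mu'd => hy;
    rewrite ?e in sh; last exact: Linked1 hx sh hy.
  + by case: (@far1 _ _ y nac); rewrite ?muy.
  + by case: (@far1 _ _ y nbd); rewrite ?muy.
  + by case: (@far1' _ _ y nac); rewrite ?muy.
  + by case: (@far1' _ _ y nbd); rewrite ?muy.
- case: (split_ h) hk => [e|e|e|[e|->]]; rewrite ?e ?mu'a ?mu'b ?mu'c ?mu'd => hk;
  case: (split_ k) hy => [e'|e'|e'|[e'|->]]; rewrite ?e' ?mu'a ?mu'b ?mu'c ?mu'd => hy;
  rewrite ?e in hx; rewrite ?e' in hk;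
  (* If neither [h] nor [k] is moved, the walk is one of [mu].  Two moved half-edges
     give a loop at [x], a loop or parallel edge of [{c, d}], or contradict [far0];
     exactly one gives a walk of length two in [mu] from [a] to [c] or from [b]
     to [d], through the edge [{x, y}]. *)
  first [ exact: (Linked2 hN kN hx hk hy) | by apply: Linked0; rewrite -hx -hy
        | by case: (far0 nac hk) | by case: (far0 nad hk)
        | by case: (far0 nbc hk) | by case: (far0 nbd hk)
        | by case: (far0 nac (esym hk)) | by case: (far0 nad (esym hk))
        | by case: (far0 nbc (esym hk)) | by case: (far0 nbd (esym hk))
        | by case: (cd_loop hk) | by case: (cd_loop (esym hk))
        | by case: (cd_par yc yd (esym hx)); rewrite muy
        | by case: (cd_par' yc yd (esym hx)); rewrite muy
        | by case: (far2 nac hk (esym hy) (esym hx))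
        | by case: (far2 nbd hk (esym hy) (esym hx))
        | by case: (far2' nac hk (esym hy) (esym hx))
        | by case: (far2' nbd hk (esym hy) (esym hx))
        | by case: (far2 nac (esym hy) hx (esym hk))
        | by case: (far2 nbd (esym hy) hx (esym hk))
        | by case: (far2' nac (esym hy) hx (esym hk))
        | by case: (far2' nbd (esym hy) hx (esym hk)) ].
Qed.
End Switch.

(** The half-edge [a] drops out because the two new edges lie on no short cycle. *)
Lemma switch_short_cycles (mu mu' : H -> H) (a c : H) :
    involutive mu -> involutive mu' -> mu' a = c -> mu' (mu a) = mu c ->
    (forall h, h \notin [set a; mu a; c; mu c] -> mu' h = mu h) ->
    (forall x y, x \in [set a; mu a] -> y \in [set c; mu c] -> ~~ linked mu set0 x y) ->
    ~~ on_short_cycle mu c ->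
  [set x | on_short_cycle mu' x] \subset [set x | on_short_cycle mu x] :\ a.
Proof.
move=> muK mu'K mu'a mu'b agree far c_ok.
have fa : ~~ on_short_cycle mu' a by apply: (@fresh_a mu mu' a (mu a) c (mu c)).
have fb : ~~ on_short_cycle mu' (mu a).
  apply: (@fresh_a mu mu' (mu a) a (mu c) c) => //.
  - move=> h hA; apply: agree; apply: contra hA; rewrite !inE -!orbA.
    by case/or4P=> ->; rewrite ?orbT.
  - by move=> x y; rewrite (setUC [set mu a]) (setUC [set mu c]); apply: far.
  - by apply: contra c_ok => /(on_short_cycle_sym muK); rewrite muK.
have fc : ~~ on_short_cycle mu' c.
  by apply: contra fa => /(on_short_cycle_sym mu'K); rewrite -mu'a mu'K.
have fd : ~~ on_short_cycle mu' (mu c).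
  by apply: contra fb => /(on_short_cycle_sym mu'K); rewrite -mu'b mu'K.
apply/subsetP=> x; rewrite !inE => bad_x.
have xA : x \notin [set a; mu a; c; mu c].
  apply/negP; rewrite !inE -!orbA => /or4P[] /eqP e; move: bad_x; rewrite e; exact: negP.
apply/andP; split; first by apply: contraNneq xA => ->; rewrite !inE eqxx.
exact: (@old_short_cycle mu mu' a (mu a) c (mu c)).
Qed.

(** The walk closing the short cycle through [a] starts at [v (mu a)], hence stays
    away from [c] and [mu c] and survives the switch.  So for given [mu'] and [a]
    there are boundedly many candidates for the old partner [mu a]. *)
Lemma switch_partner_linked (mu mu' : H -> H) (a c : H) :
    involutive mu -> involutive mu' ->
    (forall h, h \notin [set a; mu a; c; mu c] -> mu' h = mu h) ->
    (forall x y, x \in [set a; mu a] -> y \in [set c; mu c] -> ~~ linked mu set0 x y) ->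
  on_short_cycle mu a -> linked mu' set0 a (mu a).
Proof.
move=> muK mu'K agree far bad_a.
apply: (linked_sym mu'K); first by move=> h; rewrite inE.
apply: (linkedS (sub0set [set a; mu a; c; mu c])).
have -> : [set a; mu a; c; mu c] = [set a; mu a] :|: [set c; mu c].
  by apply/setP => x; rewrite !inE -!orbA.
apply: (@linked_agree mu) => [h hA|].
  by rewrite agree //; move: hA; rewrite !inE -!orbA.
by apply: linked_avoid => // y; apply: far; rewrite !inE eqxx orbT.
Qed.

(** * Counting matchings without short cycles *)

Section Count.
Variables (p : {perm H}) (d : nat).
Hypothesis p_inv : involutive p.
Hypothesis p_nofix : forall x, p x != x.
Hypothesis deg : forall u, #|[set h | v h == u]| <= d.

Local Notation ball_bound := (d + d ^ 2 + d ^ 3).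

Definition matching (s : {perm H}) : {perm H} := (p ^ s)%g.

Lemma matchingE s x : matching s (s x) = s (p x).
Proof. by rewrite /matching conjgE !permM permK. Qed.

Lemma matchingK s : involutive (matching s).
Proof. by move=> x; rewrite -(permKV s x) !matchingE p_inv. Qed.

Lemma matching_nofix s x : matching s x != x.
Proof. by rewrite -(permKV s x) matchingE (inj_eq perm_inj) p_nofix. Qed.

(** As [matching] is conjugation of [p], multiplying by a transposition conjugates
    the matching by it, which exchanges the roles of [matching s a] and [c]. *)
Definition switch (s : {perm H}) (a c : H) : {perm H} := (s * tperm (matching s a) c)%g.

Lemma matching_switch s a c x :
  matching (switch s a c) (tperm (matching s a) c x)
    = tperm (matching s a) c (matching s x).
Proof.
by rewrite /switch {1}/matching conjgM -/(matching s) conjgE !permM tpermV tpermK.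
Qed.

Lemma matching_switch_l s a c : a != c -> matching (switch s a c) a = c.
Proof.
move=> ac; have := matching_switch s a c a.
by rewrite tpermL tpermD // ?matching_nofix // eq_sym.
Qed.

Definition far_from s a : {set H} :=
  [set c | [forall x in [set a; matching s a], forall y in [set c; matching s c],
     ~~ linked (matching s) set0 x y]].

Lemma far_fromP s a c : reflect
  (forall x y, x \in [set a; matching s a] -> y \in [set c; matching s c] ->
     ~~ linked (matching s) set0 x y) (c \in far_from s a).
Proof.
rewrite inE; apply: (iffP forall_inP) => [far x y /far /forall_inP|far x xa]; first exact.
by apply/forall_inP => y; apply: far.
Qed.

Lemma far_neq s a c : c \in far_from s a -> a != c /\ matching s a != c.
Proof.
move/far_fromP=> far; split; apply/eqP => e.
  by have /linkedP[] := far a c (set21 _ _) (set21 _ _); apply: Linked0; rewrite e.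
by have /linkedP[] := far (matching s a) c (set22 _ _) (set21 _ _); apply: Linked0;
  rewrite e.
Qed.

Lemma switch_agree s a c h :
  h \notin [set a; matching s a; c; matching s c] ->
  matching (switch s a c) h = matching s h.
Proof.
rewrite !inE !negb_or -!andbA => /and4P[ha hb hc hd].
have := matching_switch s a c h.
rewrite !tpermD // ?(eq_sym _ h) //.
- by rewrite (inj_eq perm_inj) eq_sym.
- by rewrite -(inj_eq (@perm_inj _ (matching s))) matchingK eq_sym.
Qed.

Lemma matching_switch_r s a c : c \in far_from s a ->
  matching (switch s a c) (matching s a) = matching s c.
Proof.
move=> far; have [ac bc] := far_neq far.
have := matching_switch s a c c; rewrite tpermR tpermD // => [|].
  apply: contraNneq ac => /perm_inj -> //.
by rewrite eq_sym matching_nofix.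
Qed.

Lemma card_far s a : #|H| <= #|far_from s a| + 4 * ball_bound.
Proof.
pose B x := [set y | linked (matching s) set0 x y].
pose b := matching s a.
have sub : ~: far_from s a
    \subset (B a :|: matching s @^-1: B a) :|: (B b :|: matching s @^-1: B b).
  apply/subsetP => c; rewrite inE => /far_fromP nfar.
  apply: contraT; rewrite !in_setU => /norP[/norP[n1 n2] /norP[n3 n4]].
  case: nfar => x y; move: n1 n2 n3 n4; rewrite !inE => n1 n2 n3 n4.
  by move=> /orP[]/eqP-> /orP[]/eqP->.
rewrite -[leqLHS](cardsC (far_from s a)) leq_add2l.
apply: leq_trans (subset_leq_card sub) _.
have cB x : #|B x| <= ball_bound by apply: card_ball.
have cB' x : #|matching s @^-1: B x| <= ball_bound.
  by rewrite card_preimset //; apply: perm_inj.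
apply: leq_trans (leq_card_setU _ _) _.
have := leq_add (leq_trans (leq_card_setU (B a) _) (leq_add (cB a) (cB' a)))
 (leq_trans (leq_card_setU (B b) _) (leq_add (cB b) (cB' b))).
by move=> /leq_trans; apply; lia.
Qed.

Definition defects s : {set H} := [set a | on_short_cycle (matching s) a].

(** Double counting of the triples [(s, a, c)] through the injective map
    [(s, a, c) |-> (switch s a c, a, matching s a)].  It is injective because [c]
    is the new partner of [a], so the transposition can be undone.  In the image
    the third component is linked to the second in the new matching, which leaves
    boundedly many values for it. *)
Lemma switch_count (S S' : {set {perm H}}) (C : {perm H} -> H -> {set H}) :
    (forall s a c, s \in S -> a \in defects s -> c \in C s a ->
       c \in far_from s a /\ switch s a c \in S') ->
  \sum_(s in S) \sum_(a in defects s) #|C s a| <= #|S'| * (#|H| * ball_bound).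
Proof.
move=> SC.
pose T := [set t : {perm H} * (H * H) |
  [&& t.1 \in S, t.2.1 \in defects t.1 & t.2.2 \in C t.1 t.2.1]].
pose T' := [set t : {perm H} * (H * H) |
  (t.1 \in S') && linked (matching t.1) set0 t.2.1 t.2.2].
have cardT : #|T| = \sum_(s in S) \sum_(a in defects s) #|C s a|.
  rewrite -sum1_card (partition_big (fun t => t.1) (mem S)) /=;
    last by move=> t; rewrite inE => /and3P[].
  apply: eq_bigr => s sS.
  rewrite (partition_big (fun t => t.2.1) (mem (defects s))) /=; last first.
    by move=> t; rewrite inE => /andP[/and3P[_ ? _] /eqP <-].
  apply: eq_bigr => a aD.
  rewrite sum1_card -(card_imset (f := fun c => (s, (a, c))) (C s a));
    last by move=> c c' [].
  apply: eq_card => -[s' [a' c]]; rewrite unfold_in !inE /=.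
  apply/idP/imsetP => [/andP[/andP[/and3P[h1 h2 h3] /eqP h4] /eqP h5]|[c' cC [-> -> ->]]].
    by exists c; rewrite -?h4 -?h5.
  by rewrite sS cC !eqxx; rewrite inE in aD; rewrite aD.
have cardT' : #|T'| <= #|S'| * (#|H| * ball_bound).
  rewrite -sum1_card (partition_big (fun t => t.1) (mem S')) /=;
    last by move=> t; rewrite inE => /andP[].
  rewrite -[leqRHS]sum_nat_const; apply: leq_sum => s sS.
  have -> : #|H| * ball_bound = \sum_(a : H) ball_bound by rewrite sum_nat_const.
  rewrite (partition_big (fun t => t.2.1) predT) //=.
  apply: leq_sum => a _; rewrite sum1_card.
  apply: leq_trans (card_ball deg (matching s) a).
  rewrite -(card_imset (f := fun c => (s, (a, c))) [set y | _]); last by move=> c c' [].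
  apply/subset_leq_card/subsetP => -[s' [a' c]]; rewrite unfold_in !inE /=.
  move=> /andP[/andP[/andP[h1 h2] /eqP h4] /eqP h5]; apply/imsetP.
  by exists c; rewrite ?inE -?h4 -?h5.
rewrite -cardT; apply: leq_trans cardT'.
pose phi (t : {perm H} * (H * H)) :=
  (switch t.1 t.2.1 t.2.2, (t.2.1, matching t.1 t.2.1)).
pose psi (t : {perm H} * (H * H)) :=
  ((t.1 * tperm t.2.2 (matching t.1 t.2.1))%g, (t.2.1, matching t.1 t.2.1)).
have TP t : t \in T -> [/\ t.2.2 \in far_from t.1 t.2.1,
  switch t.1 t.2.1 t.2.2 \in S' & t.2.1 \in defects t.1].
  by rewrite inE => /and3P[sS aD cC]; have [] := SC _ _ _ sS aD cC.
have phiK : {in T, cancel phi psi}.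
  move=> [s [a c]] /TP[/= far _ _]; have [ac bc] := far_neq far.
  by rewrite /phi /psi /= matching_switch_l // /switch -mulgA tperm2 mulg1.
rewrite -(card_in_imset (can_in_inj phiK));
  apply/subset_leq_card/subsetP => _ /imsetP[t tT ->].
have [far tS aD] := TP _ tT; rewrite inE /= tS /=.
apply: (@switch_partner_linked _ _ _ t.2.2 (matchingK _) (matchingK _)).
- exact: switch_agree.
- exact/far_fromP.
- by rewrite inE in aD.
Qed.

(** [switch_count] on all permutations, with every far [c] allowed: the mean
    number of half-edges on short cycles is bounded. *)
Lemma sum_defects : 8 * ball_bound <= #|H| ->
  \sum_s #|defects s| <= 2 * ball_bound * #|{perm H}|.
Proof.
move=> leH.
have := @switch_count setT setT far_from (fun s a c _ _ far => conj far (in_setT _)).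
have [H0|H0] := posnP #|H|.
  move=> _; rewrite big1 // => s _; apply/eqP; rewrite -leqn0.
  by rewrite -[X in _ <= X]H0 max_card.
have le1 : #|H| * \sum_s #|defects s|
   <= 2 * \sum_(s in setT) \sum_(a in defects s) #|far_from s a|.
  rewrite !big_distrr /= (eq_bigl (fun s => s \in [set: {perm H}])) => [|s];
    last by rewrite in_setT.
  apply: leq_sum => s _; rewrite mulnC -sum_nat_const big_distrr /=;
    apply: leq_sum => a _.
  move: leH (card_far s a).
  by move: (ball_bound) #|far_from s a| #|H| => B F h; lia.
rewrite cardsT => le2; rewrite -(leq_pmul2l H0); apply: leq_trans le1 _.
move: le2; move: (\sum_(s in _) _) #|{perm H}| #|H| => X Y Z; nia.
Qed.

Definition few_defects k : {set {perm H}} := [set s | #|defects s| <= k].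

(** [switch_count] from the permutations with exactly [k] defects to those with
    fewer, where [c] is required to be far from [a] and not a defect. *)
Lemma few_defects_step K k : k <= K -> 8 * ball_bound + 2 * K <= #|H| -> 0 < #|H| ->
  #|few_defects k| <= (1 + 2 * ball_bound) * #|few_defects k.-1|.
Proof.
case: k => [|k] kK leH H_gt0; first by rewrite leq_pmull.
rewrite /=; pose S := few_defects k.+1 :\: few_defects k.
have split_ : #|few_defects k.+1| <= #|few_defects k| + #|S|.
  by rewrite -(cardsID (few_defects k)) leq_add2r subset_leq_card // subsetIr.
have SP s : s \in S -> #|defects s| = k.+1.
  by rewrite !inE -ltnNge => /andP[h1 h2]; apply/eqP; rewrite eqn_leq h1 h2.
pose C s a := far_from s a :\: defects s.
have SC s a c : s \in S -> a \in defects s -> c \in C s a ->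
    c \in far_from s a /\ switch s a c \in few_defects k.
  move=> /SP sk aD; rewrite in_setD => /andP[cD far]; split=> //;
    have [ac bc] := far_neq far.
  rewrite inE -ltnS -sk (cardsD1 a (defects s)) aD add1n ltnS.
  apply/subset_leq_card/switch_short_cycles;
    rewrite ?matching_switch_l ?matching_switch_r //.
  - exact: matchingK.
  - exact: matchingK.
  - exact: switch_agree.
  - exact/far_fromP.
  - by rewrite inE in cD.
have := switch_count SC.
have le1 : #|S| * #|H| <= 2 * \sum_(s in S) \sum_(a in defects s) #|C s a|.
  rewrite -sum_nat_const big_distrr /=; apply: leq_sum => s sS.
  apply: leq_trans (_ : \sum_(a in defects s) #|H| <= _).
    by rewrite sum_nat_const SP // leq_pmull.
  rewrite big_distrr /=; apply: leq_sum => a _.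
  have := card_far s a; have := cardsID (defects s) (far_from s a); rewrite -/(C s a);
    move: leH.
  have := subset_leq_card (subsetIr (far_from s a) (defects s)); rewrite (SP s sS).
  by move: (ball_bound) #|far_from s a| #|C s a| #|H| #|_ :&: _| => B F c h i; lia.
move: split_ le1; move: (\sum_(s in S) _) #|S| #|few_defects k.+1| #|few_defects k| =>
  X Y Z W.
move=> h1 h2 h3; apply: leq_trans h1 _; rewrite mulnDl mul1n leq_add2l.
rewrite -(leq_pmul2r H_gt0); apply: leq_trans h2 _; lia.
Qed.

Definition defect_free : {set {perm H}} := [set s | defects s == set0].

(** By Markov's inequality at least half of the permutations have at most
    [4 * ball_bound] defects, twice the bound on the mean; then
    [few_defects_step] is iterated down to zero. *)
Lemma card_defect_free : 16 * ball_bound <= #|H| -> 0 < #|H| ->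
  #|{perm H}| <= 2 * (1 + 2 * ball_bound) ^ (4 * ball_bound) * #|defect_free|.
Proof.
move=> leH H_gt0; set K := 4 * ball_bound.
have markov : #|{perm H}| <= 2 * #|few_defects K|.
  have s8 : 8 * ball_bound <= #|H| by lia.
  have := sum_defects s8.
  have le1 : #|~: few_defects K| * K.+1 <= \sum_s #|defects s|.
    rewrite -sum_nat_const big_mkcond /=; apply: leq_sum => s _; rewrite !inE -ltnNge.
    by case: ifP.
  have := cardsC (few_defects K).
  move: le1; rewrite /K; move: (ball_bound) #|{perm H}| (\sum_s #|_|) => B W X.
  move: #|~: few_defects _| #|few_defects _| => Y Z; nia.
apply: leq_trans markov _; rewrite -mulnA leq_pmul2l //.
have step k : k <= K -> #|few_defects k| <= (1 + 2 * ball_bound) ^ k * #|few_defects 0|.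
  elim: k => [|k IHk] kK; first by rewrite expn0 mul1n.
  apply: leq_trans (few_defects_step kK _ H_gt0) _; first by rewrite /K; lia.
  by rewrite (expnS _ k) -mulnA leq_mul2l IHk ?orbT // ltnW.
have -> : defect_free = few_defects 0 by apply/setP => s; rewrite !inE leqn0 cards_eq0.
exact: step.
Qed.
End Count.
End ShortCycles.

(** * The simple graph of a matching *)

Lemma card_edges_regular (G : sgraph) d :
  regular d G -> #|edges G| * 2 = #|vertex G| * d.
Proof.
move=> regG.
pose P := [set p : vertex G * vertex G | adj p.1 p.2].
have cardP : #|P| = #|vertex G| * d.
  rewrite -sum1_card (partition_big (fun p => p.1) predT) //= -sum_nat_const.
  apply: eq_bigr => u _; rewrite sum1_card -(regG u).
  rewrite -(card_imset (f := pair u) (neighbors u)); last by move=> w w' [].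
  apply: eq_card => -[u' w]; rewrite unfold_in !inE /=.
  apply/andP/imsetP => [[uw /eqP <-]|[w' uw' [-> ->]]].
    by exists w; rewrite ?inE.
  by rewrite inE in uw'; rewrite uw'.
rewrite -cardP -[in RHS]sum1_card.
rewrite (partition_big (fun p : vertex G * vertex G => [set p.1; p.2])
           (mem (edges G))) /=; last first.
  by move=> p; rewrite inE => pP; apply/imsetP; exists p; rewrite ?inE.
rewrite -[LHS]sum_nat_const; apply: eq_bigr => e /imsetP[[x y]];
  rewrite /= inE /= => xy ->.
rewrite sum1_card.
have neq : (x, y) != (y, x).
  by apply/eqP => -[exy _]; move: xy; rewrite exy adj_irrefl.
transitivity #|[set (x, y); (y, x)]|; first by rewrite cards2 neq.
apply: eq_card => -[z w]; rewrite [RHS]unfold_in !inE /=.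
apply/idP/andP => [/orP[]/eqP[-> ->]|[zw /eqP E]].
- by rewrite xy eqxx.
- by rewrite adj_sym xy setUC eqxx.
- have zE : z \in [set x; y] by rewrite -E set21.
  have wE : w \in [set x; y] by rewrite -E set22.
  move: zE wE zw; rewrite !inE => /orP[]/eqP-> /orP[]/eqP->;
    rewrite ?adj_irrefl // ?eqxx ?orbT //.
Qed.

Section HalfEdgeGraph.
Variables (H V : finType) (v : H -> V) (mu : H -> H).
Hypothesis muK : involutive mu.

(** Loops are discarded so that every matching gives a simple graph, without
    reference to short cycles. *)
Definition half_edge_adj : rel V :=
  fun u w => (u != w) && [exists h, (v h == u) && (v (mu h) == w)].

Lemma half_edge_adj_sym : symmetric half_edge_adj.
Proof.
suff sub u w : half_edge_adj u w -> half_edge_adj w u.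
  by move=> u w; apply/idP/idP; apply: sub.
case/andP=> uw /existsP[h /andP[hu hw]]; rewrite /half_edge_adj eq_sym uw.
by apply/existsP; exists (mu h); rewrite muK hw hu.
Qed.

Lemma half_edge_adj_irrefl : irreflexive half_edge_adj.
Proof. by move=> u; rewrite /half_edge_adj eqxx. Qed.

Definition half_edge_graph : sgraph := SGraph half_edge_adj_sym half_edge_adj_irrefl.

Hypothesis no_short : forall h, ~~ on_short_cycle v mu h.

Lemma no_loop h : v (mu h) != v h.
Proof.
by apply: contra (no_short h) => /eqP e; apply/linkedP; apply: Linked0.
Qed.

Lemma half_edge_graph_triangle_free : triangle_free half_edge_graph.
Proof.
move=> x y z [/andP[xy /existsP[a /andP[/eqP ax /eqP ay]]]].
move=> /andP[yz /existsP[h /andP[/eqP hy /eqP hz]]].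
move=> /andP[zx /existsP[k /andP[/eqP kz /eqP kx]]].
have /negP := no_short a; apply; apply/linkedP.
have out l : v l != v a -> v (mu l) != v a -> l \notin [set a; mu a].
  by rewrite !inE => la mla; apply/norP; split;
    [apply: contraNneq la => ->|apply: contraNneq mla => ->; rewrite muK].
have out' l : v l != v (mu a) -> v (mu l) != v (mu a) -> l \notin [set a; mu a].
  by rewrite !inE => la mla; apply/norP; split;
    [apply: contraNneq mla => ->|apply: contraNneq la => ->].
apply: (@Linked2 _ _ _ _ _ _ _ h k); rewrite ?hy ?hz ?kx ?ax ?ay //.
- by apply: out; rewrite ?hy ?hz ax // eq_sym.
- by apply: out'; rewrite ?kx ?kz ay // eq_sym.
Qed.

(** Two half-edges at [u] leading to the same vertex would be parallel edges. *)
Lemma half_edge_graph_regular d :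
  (forall u, #|[set h | v h == u]| = d) -> regular d half_edge_graph.
Proof.
move=> deg u; rewrite -(deg u).
rewrite -(card_in_imset (f := fun h => v (mu h)) (D := [set h | v h == u])); last first.
  move=> h k; rewrite !inE => /eqP hu /eqP ku e; apply/eqP.
  apply: contraT => hk; have /negP := no_short h; case; apply/linkedP.
  apply: (@Linked1 _ _ _ _ _ _ _ (mu k)); rewrite ?muK ?ku ?hu ?e //.
  rewrite !inE negb_or (inj_eq (can_inj muK)) (eq_sym k) hk andbT.
  by apply: contraNneq (no_loop h) => kh; rewrite hu -kh muK ku.
apply: eq_card => w; rewrite !inE /=;
  apply/andP/imsetP => [[uw /existsP[h /andP[hu /eqP hw]]]|[h]].
  by exists h; rewrite ?inE.
rewrite inE => /eqP hu ->; split; first by rewrite -hu eq_sym no_loop.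
by apply/existsP; exists h; rewrite hu !eqxx.
Qed.

Lemma half_edge_graph_coloring q (f : {ffun V -> 'I_q}) h :
  @proper_coloring half_edge_graph q f -> f (v h) != f (v (mu h)).
Proof.
move=> /forallP/(_ (v h))/forallP/(_ (v (mu h)))/implyP; apply.
by rewrite /= /half_edge_adj eq_sym no_loop; apply/existsP; exists h; rewrite !eqxx.
Qed.
End HalfEdgeGraph.

(** * Averaging *)

Lemma exists_pairing (H : finType) : ~~ odd #|H| ->
  exists p : {perm H}, involutive p /\ forall x, p x != x.
Proof.
move=> evenH.
have cardE : #|H| = #|{: bool * 'I_(#|H|./2)}|.
  by rewrite card_prod card_bool card_ord mul2n even_halfK.
pose f h : bool * 'I_(#|H|./2) := enum_val (cast_ord cardE (enum_rank h)).
pose g x : H := enum_val (cast_ord (esym cardE) (enum_rank x)).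
have fK : cancel f g by move=> h; rewrite /f /g enum_valK cast_ordK enum_rankK.
have gK : cancel g f by move=> h; rewrite /f /g enum_valK cast_ordKV enum_rankK.
pose r h := g (~~ (f h).1, (f h).2).
have rK : involutive r by move=> h; rewrite /r gK /= negbK -surjective_pairing fK.
exists (perm (can_inj rK)); split=> h; rewrite !permE ?rK //.
by apply/eqP => /(congr1 f); rewrite gK => /(congr1 fst) /=; case: (f h).1.
Qed.

Lemma exists_le_average (T : finType) (A : {set T}) (F : T -> nat) K :
  0 < #|A| -> \sum_(s in A) F s <= #|A| * K -> exists2 s, s \in A & F s <= K.
Proof.
move=> A_gt0 leK; apply/exists_inP; apply: contraLR leK; rewrite negb_exists_in -ltnNge.
move=> /forall_inP gtK; rewrite -sum_nat_const.
have [s sA] : exists s, s \in A by apply/set0Pn; rewrite -card_gt0.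
rewrite (bigD1 s) //= [ltnRHS](bigD1 s) //=.
have := gtK s sA; rewrite -ltnNge => lt_s; rewrite -addSn; apply: leq_add => //.
by apply: leq_sum => t /andP[tA _]; apply: ltnW; rewrite ltnNge gtK.
Qed.

Section Existence.
Variables (H V : finType) (v : H -> V) (d q m : nat).
Hypothesis deg : forall u, #|[set h | v h == u]| = d.
Local Notation ball_bound := (d + d ^ 2 + d ^ 3).
Hypothesis H_even : #|H| = m.*2.
Hypothesis H_gt0 : 0 < #|H|.
Hypothesis H_large : 16 * ball_bound <= #|H|.

(** The sum over the defect-free permutations of the number of colorings is at
    most the sum over all permutations, which is estimated one color assignment
    at a time; the factor [2 * (1 + 2 * ball_bound) ^ (4 * ball_bound)] is the
    price of conditioning on defect-free permutations. *)
Lemma exists_graph_few_colorings :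
  exists2 mu : H -> H, exists muK : involutive mu,
     q ^ m * num_colorings (half_edge_graph v muK) q
      <= q ^ #|V| * (q.-1 ^ m * #|H|.+1 * (2 * (1 + 2 * ball_bound) ^ (4 * ball_bound)))
   & forall h, ~~ on_short_cycle v mu h.
Proof.
have [|p [pK p_nofix]] := @exists_pairing H; first by rewrite H_even odd_double.
pose D := 2 * (1 + 2 * ball_bound) ^ (4 * ball_bound); rewrite -/D.
pose Gd := defect_free v p.
have leD : #|H|`! <= D * #|Gd|.
  by rewrite -card_perm_type; apply: card_defect_free => // u; rewrite deg.
have Gd_gt0 : 0 < #|Gd|.
  by rewrite lt0n; apply: contraTneq leD => ->; rewrite muln0 -ltnNge fact_gt0.
pose graph s := half_edge_graph v (matchingK pK s).
have good s : s \in Gd -> forall h, ~~ on_short_cycle v (matching p s) h.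
  by rewrite inE => /eqP e h; have := in_set0 h; rewrite -e inE => ->.
have le_sum : \sum_(s in Gd) num_colorings (graph s) q
   <= \sum_(f : {ffun V -> 'I_q}) #|proper_on p (f \o v) setT|.
  have -> : \sum_(s in Gd) num_colorings (graph s) q =
      \sum_(s in Gd) \sum_(f : {ffun V -> 'I_q} | @proper_coloring (graph s) q f) 1.
    by apply: eq_bigr => s _; rewrite sum1_card; apply: eq_card => f; rewrite inE.
  rewrite (exchange_big_dep predT) //=; apply: leq_sum => f _.
  rewrite sum1_card; apply/subset_leq_card/subsetP => s;
    rewrite unfold_in /= => /andP[sG fP].
  rewrite inE; apply/forall_inP => x _ /=.
  by have := half_edge_graph_coloring (good s sG) (s x) fP; rewrite matchingE.
have le_f (f : {ffun V -> 'I_q}) : q ^ m * #|proper_on p (f \o v) setT|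
     <= q.-1 ^ m * #|H|`! * #|H|.+1.
  have := @card_proper_on_le H p pK p_nofix q (f \o v) m setT (fun _ _ => in_setT _).
  by rewrite cardsT => /(_ H_even); rewrite setCT cards0 muln1 mulnC.
have [|s sG le_s] := @exists_le_average _ Gd (fun s => q ^ m * num_colorings (graph s) q)
    (q ^ #|V| * (q.-1 ^ m * #|H|.+1 * D)) Gd_gt0.
  apply: (@leq_trans (q ^ m * \sum_(f : {ffun V -> 'I_q}) #|proper_on p (f \o v) setT|)).
    by rewrite -big_distrr leq_mul2l le_sum orbT.
  rewrite big_distrr /=.
  apply: (@leq_trans (\sum_(f : {ffun V -> 'I_q}) q.-1 ^ m * #|H|`! * #|H|.+1)).
    by apply: leq_sum => f _; exact: le_f.
  rewrite sum_nat_const card_ffun card_ord.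
  have -> : #|Gd| * (q ^ #|V| * (q.-1 ^ m * #|H|.+1 * D))
      = q ^ #|V| * (q.-1 ^ m * (D * #|Gd|) * #|H|.+1) by nia.
  by rewrite !leq_mul.
by exists (matching p s); [exists (matchingK pK s)|exact: good].
Qed.
End Existence.

(** * Growth of the correction factor *)

Local Open Scope ring_scope.

Lemma exp_sub_le_1D (R : realType) (g : R) : 0 <= g -> expR (g / (1 + g)) <= 1 + g.
Proof.
move=> g_ge0; have y_gt0 : 0 < 1 + g by lra.
have := expR_ge1Dx (- (g / (1 + g))); rewrite expRN.
have -> : 1 + - (g / (1 + g)) = (1 + g)^-1 by field; rewrite gt_eqF.
by rewrite lef_pV2 // posrE // expR_gt0.
Qed.

(** With [g = 2 * ln n / n <= 1 / 3], the right-hand side is at least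
    [expR (n * g / (1 + g)) >= expR (3 / 2 * ln n)], that is [n] times the square
    root of [n]; the square root is written [E] in the proof. *)
Lemma natM_le_exp_1D_ln (R : realType) (K n : nat) : (K ^ 2 <= n)%N -> (144 <= n)%N ->
  (K * n)%:R <= (1 + 2 * ln n%:R / n%:R) ^+ n :> R.
Proof.
move=> leKn le_n; set x : R := n%:R; set L := ln x; set g := 2 * L / x.
have x_ge : 144 <= x by rewrite (ler_nat R 144).
have x_gt0 : 0 < x by lra.
have expL : expR L = x by rewrite lnK.
set E := expR (L / 2); have E_gt0 : 0 < E by apply: expR_gt0.
have EE : E * E = x by rewrite -expRD -expL; congr expR; lra.
(* This is where [144] comes from: it makes [2 * (E - 1) <= E ^ 2 / 6], whence
   [ln n <= n / 6] and [g <= 1 / 3]. *)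
have E12 : 12 <= E by nra.
have L_ge0 : 0 <= L by rewrite ln_ge0 //; lra.
have LE : L <= 2 * (E - 1) by have := expR_ge1Dx (L / 2); rewrite -/E; lra.
have KE : K%:R <= E.
  have : K%:R * K%:R <= E * E by rewrite EE -natrM ler_nat mulnn.
  by have := ler0n R K; nra.
have gx : x * g = 2 * L by rewrite /g; field; rewrite gt_eqF.
have g_ge0 : 0 <= g by rewrite /g divr_ge0 ?mulr_ge0 // ltW.
have g_le : g <= 1 / 3 by nra.
apply: le_trans (_ : expR (g / (1 + g)) ^+ n <= _); last first.
  by rewrite lerXn2r ?nnegrE ?exp_sub_le_1D ?expR_ge0 // addr_ge0.
rewrite -expRM_natl -/x mulrA gx.
apply: le_trans (_ : expR (L + L / 2) <= _).
  by rewrite expRD expL natrM mulrC -/x -/E ler_pM2l.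
rewrite ler_expR ler_pdivlMr; last by lra.
nra.
Qed.

(** * The theorem *)

Theorem theorem1p3 (R : realType) (Delta q : nat)
    (hDelta : (0 < Delta)%N) (hq : (0 < q)%N) :
  exists N : nat, forall n : nat, (N <= n)%N -> ~~ odd (Delta * n) ->
    exists G : sgraph,
      [/\ triangle_free G,
          regular Delta G,
          #|vertex G| = n,
          #|edges G| = ((Delta * n)./2)%N &
          let m := #|edges G| in
          let gamma : R := 2 * ln n%:R / n%:R in
          (num_colorings G q)%:R
            <= (1 - 1 / q%:R) ^+ m * ((1 + gamma) * q%:R) ^+ n :> R].
Proof.
(* [D] bounds the inverse proportion of defect-free matchings, and
   [(#|H| + 1) * D <= K * n]. *)
pose B := (Delta + Delta ^ 2 + Delta ^ 3)%N.
pose D := (2 * (1 + 2 * B) ^ (4 * B))%N.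
pose K := ((Delta + 1) * D)%N.
exists (16 * B + K ^ 2 + 144)%N => n le_n even_n.
pose H : finType := ('I_n * 'I_Delta)%type; pose v (h : H) := h.1.
pose m := ((Delta * n)./2)%N.
have deg u : #|[set h : H | v h == u]| = Delta.
  transitivity #|[set (u, i) | i : 'I_Delta]|; last first.
    by rewrite card_imset ?card_ord // => i j [].
  apply: eq_card => -[w i]; rewrite !inE /v /=; apply/eqP/imsetP => [->|[j _ [-> _]] //].
  by exists i.
have cardH : #|H| = (Delta * n)%N by rewrite card_prod !card_ord mulnC.
have cardHm : #|H| = m.*2 by rewrite cardH even_halfK.
have le_nH : (n <= #|H|)%N by rewrite cardH leq_pmull.
have H_gt0 : (0 < #|H|)%N by apply: leq_trans le_nH; lia.
have H_large : (16 * B <= #|H|)%N by apply: leq_trans le_nH; lia.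
have [mu [muK le_col] good] := @exists_graph_few_colorings _ _ v Delta q m deg cardHm
  H_gt0 H_large.
rewrite card_ord -/B -/D in le_col.
have reg := half_edge_graph_regular (muK := muK) good deg.
have cardE : #|edges (half_edge_graph v muK)| = m.
  by have := card_edges_regular reg; rewrite /= card_ord muln2 mulnC -cardH cardHm; lia.
exists (half_edge_graph v muK); split=> //.
- exact: half_edge_graph_triangle_free.
- by rewrite /= card_ord.
move=> m' gamma; rewrite /m' cardE.
set c := num_colorings _ _ in le_col *.
have q_gt0 : 0 < q%:R :> R by rewrite ltr0n.
have -> : 1 - 1 / q%:R = q.-1%:R / q%:R :> R.
  by rewrite -subn1 natrB // mulrBl divff // gt_eqF.
rewrite expr_div_n exprMn mulrAC ler_pdivlMr ?exprn_gt0 //.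
apply: le_trans (_ : q.-1%:R ^+ m * (K * n)%:R * q%:R ^+ n <= _).
  have le_nat : (q ^ m * c <= q ^ n * (q.-1 ^ m * (K * n)))%N.
    apply: leq_trans le_col _; rewrite -mulnA leq_mul // leq_mul //.
    by rewrite cardH /K mulnAC leq_mul2r; apply/orP; right; lia.
  move: le_nat; rewrite -(ler_nat R) !natrM !natrX.
  by rewrite [_ * c%:R]mulrC [_ * (_ ^+ m * _)]mulrC.
rewrite -!mulrA ler_wpM2l ?exprn_ge0 // ler_wpM2r ?exprn_ge0 //.
apply: natM_le_exp_1D_ln; lia.
Qed.
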